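(* Let $L$ be an event log over a finite set of activities $A_L$, let $a_s,a_f\notin A_L$ ($a_s\ne a_f$) be the fresh start and end activities of the USE-transformation $L'=\mathrm{USE}(L)$, and let $\mathcal{C}$ be a causal relation oracle. Let $W=(P,T,F,p_i,p_o,\lambda)$ be the net returned by the ILP-Based Process Discovery algorithm on input $(L,\mathcal{C})$. If $W$ is a workflow net, then $W$ is relaxed sound.
   Context: An event log is a finite bag of finite sequences (traces) over a finite activity set $A_L$; $\overline{L}$ denotes the set of all prefixes (including $\epsilon$) of its traces; $\vec p(\sigma)$ is the Parikh vector of $\sigma$. $\mathrm{USE}(L)$ replaces each trace $\sigma$ of $L$ by $\langle a_s\rangle\cdot\sigma\cdot\langle a_f\rangle$. A causal relation oracle is any function mapping a bag of traces to a set of pairs of its activities. For $a,b\in A'=A_L\cup\{a_s,a_f\}$, $ILP_{(L',a\to b)}$ is the integer program over $m\in\{0,1\}$, $\vec x,\vec y\in\{0,1\}^{|A'|}$ (minimizing some fixed linear objective) with constraints: for every nonempty $\sigma=\sigma'\cdot\langle c\rangle\in\overline{L'}$, $m+\vec p(\sigma')^\top\vec x-\vec p(\sigma)^\top\vec y\ge0$; for every $\sigma\in L'$, $m+\vec p(\sigma)^\top(\vec x-\vec y)=0$; $\sum_c\vec x(c)+\sum_c\vec y(c)\ge1$; $m=0$, $\vec x(a)=1$, $\vec y(b)=1$. ILP-Based Process Discovery algorithm on $(L,\mathcal{C})$: set $T=\{t_c\mid c\in A'\}$, $P=F=\emptyset$. For each $(a,b)\in\mathcal{C}(L')$: take a solution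 $(m,\vec x,\vec y)$ of $ILP_{(L',a\to b)}$, add a new place $p_{(a,b)}$, and for each $c\in A'$ add arc $(t_c,p_{(a,b)})$ if $\vec x(c)=1$ and arc $(p_{(a,b)},t_c)$ if $\vec y(c)=1$. Then add new places $p_i,p_o$ with arcs $(p_i,t_{a_s})$ and $(t_{a_f},p_o)$. Labelling: $\lambda(t_c)=c$ for $c\in A_L$, $\lambda(t_{a_s})=\lambda(t_{a_f})=\tau$ (silent). Return $(P,T,F,p_i,p_o,\lambda)$. A WF-net is $(P,T,F,p_i,p_o,\lambda)$ with $p_i\ne p_o$, $\bullet p_i=\emptyset$, $p_o\bullet=\emptyset$, and every node on a directed path from $p_i$ to $p_o$ (where $\bullet x,x\bullet$ are pre- and post-sets w.r.t. $F$). A marking is a multiset of places. Transition $t$ is enabled in $M$ if $M(p)>0$ for all $p\in\bullet t$; firing it yields $M'$ with $M'(p)=M(p)-1$ for $p\in\bullet t\setminus t\bullet$, $M'(p)=M(p)+1$ for $p\in t\bullet\setminus\bullet t$, $M'(p)=M(p)$ otherwise; write $M\xrightarrow{t}M'$, and $M\rightsquigarrow M'$ if $M'$ is reachable from $M$ by a finite (possibly empty) sequence of firings. $W$ is relaxed sound iff for every $t\in T$ there exist markings $M,M'$ with $[p_i]\rightsquigarrow M$, $M\xrightarrow{t}M'$ and $M'\rightsquigarrow[p_o]$, where $[p]$ is the marking with one token in $p$ and none elsewhere.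
   Formalization: The activity set A_L is taken to be exactly the set of activities occurring in the traces of L; if A_L could contain an activity that occurs in no trace, its transition could be dead in a workflow net and the claim would fail. *)

(* Defs.v *)
From HB Require Import structures.
From mathcomp Require Import all_boot all_order all_algebra finmap multiset.
From Stdlib Require Export Relation_Operators.

Set Implicit Arguments.
Unset Strict Implicit.
Unset Printing Implicit Defensive.

Import GRing.Theory Num.Theory.
Local Open Scope mset_scope.
Local Open Scope fset_scope.
Local Open Scope ring_scope.

(* Activities are drawn from an arbitrary universe [A]; a bag of traces is a  *)
(* finite multiset of finite sequences over [A].                              *)
Definition log (A : choiceType) := {mset seq A}.

(* For an event log [L], this is the activity set A_L. *)
Definition activities (A : choiceType) (L : log A) : {fset A} :=
  [fset c in flatten (enum_mset L)].

Definition prefix_closure (A : choiceType) (L : log A) : pred (seq A) :=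
  fun s => has (prefix s) (enum_mset L).

Definition parikh (A : choiceType) (s : seq A) (c : A) : nat := count_mem c s.

(* [seq_mset] keeps multiplicities, so this replaces each trace occurrence. *)
Definition USE (A : choiceType) (L : log A) (a_s a_f : A) : log A :=
  seq_mset [seq a_s :: rcons s a_f | s <- enum_mset L].

Definition use_alphabet (A : choiceType) (L : log A) (a_s a_f : A) : {fset A} :=
  activities L `|` [fset a_s; a_f].

Definition is_causal_oracle (A : choiceType)
    (C : log A -> {fset A * A}) : Prop :=
  forall (K : log A) (ab : A * A),
    ab \in C K -> (ab.1 \in activities K) && (ab.2 \in activities K).

(* The 0/1-valued variables are booleans, coerced to 0 and 1 in arithmetic. *)
Record ilp_point (X : finType) := IlpPoint {
  ilp_m : bool;
  ilp_x : {ffun X -> bool};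
  ilp_y : {ffun X -> bool}
}.

Record linear_objective (R : realFieldType) (X : finType) := LinearObjective {
  cost_m : R;
  cost_x : {ffun X -> R};
  cost_y : {ffun X -> R}
}.

Definition objective_value (R : realFieldType) (X : finType)
    (z : linear_objective R X) (v : ilp_point X) : R :=
  cost_m z * (ilp_m v)%:R + \sum_(c : X) cost_x z c * (ilp_x v c)%:R
    + \sum_(c : X) cost_y z c * (ilp_y v c)%:R.

Definition parikh_dot (A : choiceType) (X : {fset A}) (s : seq A)
    (u : {ffun X -> bool}) : int :=
  \sum_(c : X) (parikh s (val c))%:R * (u c)%:R.

Record ilp_feasible (A : choiceType) (X : {fset A}) (K : log A) (a b : X)
    (v : ilp_point X) : Prop := IlpFeasible {
  ilp_prefix : forall (s : seq A) (c : A),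
    rcons s c \in prefix_closure K ->
    0 <= (ilp_m v)%:R + parikh_dot s (ilp_x v)
           - parikh_dot (rcons s c) (ilp_y v);
  ilp_empty : forall s : seq A, s \in K ->
    (ilp_m v)%:R + (parikh_dot s (ilp_x v) - parikh_dot s (ilp_y v)) = 0;
  ilp_nontrivial :
    1 <= \sum_(c : X) (ilp_x v c)%:R + \sum_(c : X) (ilp_y v c)%:R :> int;
  ilp_unmarked : ilp_m v = false;
  ilp_source : ilp_x v a = true;
  ilp_target : ilp_y v b = true
}.

Definition ilp_solution (A : choiceType) (X : {fset A}) (R : realFieldType)
    (z : linear_objective R X) (K : log A) (a b : X) (v : ilp_point X) : Prop :=
  ilp_feasible K a b v /\
  forall w : ilp_point X, ilp_feasible K a b w ->
    objective_value z v <= objective_value z w.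

(* A tuple (P, T, F, p_i, p_o, lambda). The flow relation F is given by its   *)
(* two halves: [arc_pt] inside P x T and [arc_tp] inside T x P. The label     *)
(* [None] is the silent label tau.                                            *)
Record net (A : Type) := Net {
  place : finType;
  trans : finType;
  arc_pt : place -> trans -> bool;
  arc_tp : trans -> place -> bool;
  p_i : place;
  p_o : place;
  label : trans -> option A
}.

Definition node (A : Type) (W : net A) : finType := (place W + trans W)%type.

Definition flow (A : Type) (W : net A) : rel (node W) :=
  fun x y => match x, y with
  | inl p, inr t => arc_pt p t
  | inr t, inl p => arc_tp t p
  | _, _ => false
  end.

Definition preset (A : Type) (W : net A) (x : node W) : {set node W} :=
  [set y | flow y x].

Definition postset (A : Type) (W : net A) (x : node W) : {set node W} :=
  [set y | flow x y].

Definition workflow_net (A : Type) (W : net A) : Prop :=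
  let i : node W := inl (p_i W) in
  let o : node W := inl (p_o W) in
  [/\ p_i W != p_o W, preset i = set0, postset o = set0 &
      forall x : node W, exists s : seq (node W),
        [/\ path (@flow A W) i s, last i s = o & x \in i :: s]].

Definition marking (A : Type) (W : net A) := {mset place W}.

Definition enabled (A : Type) (W : net A) (M : marking W) (t : trans W) : Prop :=
  forall p : place W, inl p \in preset (inr t : node W) -> (0 < M p)%N.

Definition fires (A : Type) (W : net A) (t : trans W) (M M' : marking W) : Prop :=
  let ins := preset (inr t : node W) in
  let outs := postset (inr t : node W) in
  enabled M t /\
  forall p : place W,
    M' p = if inl p \in ins :\: outs then (M p - 1)%N
           else if inl p \in outs :\: ins then (M p + 1)%N
           else M p.

Definition reachable (A : Type) (W : net A) : marking W -> marking W -> Prop :=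
  clos_refl_trans _ (fun M M' => exists t, fires t M M').

Definition relaxed_sound (A : Type) (W : net A) : Prop :=
  forall t : trans W, exists M M' : marking W,
    [/\ reachable [mset p_i W] M, fires t M M' & reachable M' [mset p_o W]].

(* One place [inl (a, b)] per oracle pair (pairs with equal ILP solutions     *)
(* still get distinct places); [inr false] is p_i and [inr true] is p_o.      *)
Definition discovered_net (A : choiceType) (X : {fset A}) (a_s a_f : A)
    (D : {fset A * A}) (sol : A * A -> ilp_point X) : net A :=
  @Net A (D + bool)%type X
    (fun p c => match p with
       | inl ab => ilp_y (sol (val ab)) c
       | inr o => ~~ o && (val c == a_s)
       end)
    (fun c p => match p with
       | inl ab => ilp_x (sol (val ab)) c
       | inr o => o && (val c == a_f)
       end)
    (inr false) (inr true)
    (fun c => if val c \in [:: a_s; a_f] then None else Some (val c)).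

(* The choice of an ILP solution makes the algorithm nondeterministic: [W] is *)
(* a possible result on input [(L, C)], with objective [z]. If some program   *)
(* has no solution, there is no result.                                       *)
Definition ilp_discovery (A : choiceType) (R : realFieldType) (L : log A)
    (a_s a_f : A) (z : linear_objective R (use_alphabet L a_s a_f))
    (C : log A -> {fset A * A}) (W : net A) : Prop :=
  let L' := USE L a_s a_f in
  exists sol : A * A -> ilp_point (use_alphabet L a_s a_f),
    (forall a b : use_alphabet L a_s a_f,
       (val a, val b) \in C L' -> ilp_solution z L' a b (sol (val a, val b))) /\
    W = discovered_net a_s a_f (C L') sol.

(* Main.v *)
Require Import Defs.
From mathcomp Require Import all_boot all_order all_algebra finmap multiset zify.

(* Read on the letters of a trace, the prefix constraints of the integer
   programs say that each oracle place always holds enough tokens to fire the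
   next transition, and the trace constraints say that it ends up empty. Hence
   every trace of USE(L) replays from [p_i] to [p_o]; the places p_i and p_o
   behave well because a_s and a_f occur only at the two ends. Every transition
   occurs in such a replay, except when L is empty; but then the oracle returns
   no pair, nothing connects p_i to p_o, and the net is no workflow net. *)

Definition consumed {A : Type} {W : net A} (s : seq (trans W)) (p : place W) :=
  count (@arc_pt _ W p) s.

Definition produced {A : Type} {W : net A} (s : seq (trans W)) (p : place W) :=
  count (fun t => @arc_tp _ W t p) s.

(** This is the marking equation in closed form. The subtraction is truncated, so it gives the true
    token count only where consumption stays within the supply. *)
Definition marking_after {A : Type} {W : net A} (M : marking W)
    (s : seq (trans W)) : marking W :=
  [fsfun p in [fset q | q : place W]%fset => M p + produced s p - consumed s p].

(* The bounds for different places are independent of each other, and each is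
   exactly what the prefix constraints of the integer program provide. *)
Definition replayable {A : Type} {W : net A} (M : marking W)
    (s : seq (trans W)) : Prop :=
  forall (p : place W) (s1 s2 : seq (trans W)) (t : trans W),
    s = s1 ++ t :: s2 -> consumed (rcons s1 t) p <= M p + produced s1 p.

Lemma marking_afterE {A : Type} {W : net A} (M : marking W)
    (s : seq (trans W)) (p : place W) :
  marking_after M s p = M p + produced s p - consumed s p.
Proof. by rewrite fsfunE inE. Qed.

Lemma marking_after_nil {A : Type} {W : net A} (M : marking W) :
  marking_after M [::] = M.
Proof. by apply/msetP => p; rewrite marking_afterE addn0 subn0. Qed.

(** The bound charges the consumption of [t] before its production, so it yields enabledness and
    keeps both subtractions exact. On a self-loop the two changes cancel. *)
Lemma fires_marking_after {A : Type} {W : net A} (M : marking W)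
    (s : seq (trans W)) (t : trans W) :
  (forall p, consumed (rcons s t) p <= M p + produced s p) ->
  fires t (marking_after M s) (marking_after M (rcons s t)).
Proof.
move=> ok; split=> p; last first.
  have := ok p; rewrite !marking_afterE !inE /= /consumed /produced.
  rewrite -!cats1 !count_cat /= !addn0.
  case: (arc_pt p t); case: (arc_tp t p) => /=; lia.
have := ok p; rewrite marking_afterE inE /= /consumed -cats1 count_cat /= addn0.
by move=> + pt; rewrite pt; lia.
Qed.

Lemma reachable_replay {A : Type} {W : net A} (M : marking W)
    (s s' : seq (trans W)) :
  replayable M (s ++ s') ->
  reachable (marking_after M s) (marking_after M (s ++ s')).
Proof.
elim: s' s => [|t s' IH] s ok; first by rewrite cats0; apply: rt_refl.
rewrite -cat_rcons in ok *; apply: rt_trans (IH _ ok).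
apply: rt_step; exists t; apply: fires_marking_after => p.
by apply: (ok p s s' t); rewrite cat_rcons.
Qed.

Lemma replay_through {A : Type} {W : net A} (M : marking W)
    (s : seq (trans W)) (t : trans W) :
  replayable M s -> t \in s ->
  exists M1 M2 : marking W,
    [/\ reachable M M1, fires t M1 M2 & reachable M2 (marking_after M s)].
Proof.
move=> ok t_s; case/path.splitPr: t_s ok => s1 s2 ok.
exists (marking_after M s1), (marking_after M (rcons s1 t)); split.
(* The prefix [s1] is itself replayable: each of its splittings extends to one of the whole
   sequence. *)
- rewrite -{1}(marking_after_nil M); apply: (@reachable_replay _ _ M [::]) => p u1 u2 t' eq_s1.
  by apply: (ok p u1 (u2 ++ t :: s2)); move: eq_s1 => /= ->; rewrite -catA.
- by apply: fires_marking_after => p; apply: ok.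
- by rewrite -cat_rcons; apply: reachable_replay; rewrite cat_rcons.
Qed.

(** Exchanging the sum over activities for a count along the trace turns the terms of the integer
    program into [produced] and [consumed]. *)
Lemma parikh_dot_count {A : choiceType} {X : {fset A}} (s : seq X)
    (u : {ffun X -> bool}) :
  parikh_dot (map val s) u = (count u s)%:R%R.
Proof.
rewrite /parikh_dot /parikh; elim: s => [|d s IH] /=.
  by rewrite big1 // => c _; rewrite GRing.mul0r.
under eq_bigr do rewrite GRing.natrD GRing.mulrDl.
rewrite big_split /= IH GRing.natrD; congr (_ + _)%R.
rewrite (bigD1 d) //= eqxx GRing.mul1r big1 ?GRing.addr0 // => c cd.
by rewrite (inj_eq val_inj) eq_sym (negbTE cd) GRing.mul0r.
Qed.

Lemma ilp_feasible_enough {A : choiceType} {X : {fset A}} {K : log A} {a b : X}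
    {v : ilp_point X} {s s1 s2 : seq X} {t : X} :
  ilp_feasible K a b v -> map val s \in K -> s = s1 ++ t :: s2 ->
  count (ilp_y v) (rcons s1 t) <= count (ilp_x v) s1.
Proof.
move=> feas sK def_s; have pre : rcons (map val s1) (val t) \in prefix_closure K.
  apply/hasP; exists (map val s) => //.
  by rewrite def_s map_cat /= -cat_rcons prefix_prefix.
have := ilp_prefix feas pre.
rewrite (ilp_unmarked feas) -map_rcons !parikh_dot_count GRing.add0r.
by rewrite Num.Theory.subr_ge0 Num.Theory.ler_nat.
Qed.

Lemma ilp_feasible_balanced {A : choiceType} {X : {fset A}} {K : log A} {a b : X}
    {v : ilp_point X} {s : seq X} :
  ilp_feasible K a b v -> map val s \in K ->
  count (ilp_x v) s = count (ilp_y v) s.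
Proof.
move=> feas sK; have := ilp_empty feas sK.
rewrite (ilp_unmarked feas) !parikh_dot_count GRing.add0r => /eqP.
by rewrite GRing.subr_eq0 Num.Theory.eqr_nat => /eqP.
Qed.

Lemma mem_activities {A : choiceType} {L : log A} {c : A} :
  reflect (exists2 s, s \in L & c \in s) (c \in activities L).
Proof. by rewrite !inE; apply: flattenP. Qed.

Lemma mem_USE {A : choiceType} {L : log A} {a_s a_f : A} {s : seq A} :
  reflect (exists2 s', s' \in L & s = a_s :: rcons s' a_f)
          (s \in USE L a_s a_f).
Proof. by rewrite (perm_mem (perm_eq_seq_mset _)); apply: mapP. Qed.

Lemma USE_trace_alphabet {A : choiceType} {L : log A} {a_s a_f : A} {s : seq A} :
  s \in USE L a_s a_f -> {subset s <= use_alphabet L a_s a_f}.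
Proof.
case/mem_USE => s' s'L -> c; rewrite inE mem_rcons inE in_fsetU in_fset2.
case/or3P => [->|->|cs']; rewrite ?orbT //.
by apply/orP; left; apply/mem_activities; exists s'.
Qed.

Lemma oracle_alphabet {A : choiceType} {L : log A} {a_s a_f : A}
    {C : log A -> {fset A * A}} {ab : A * A} :
  is_causal_oracle C -> ab \in C (USE L a_s a_f) ->
  (ab.1 \in use_alphabet L a_s a_f) && (ab.2 \in use_alphabet L a_s a_f).
Proof.
by move=> oracleC /oracleC /andP[/mem_activities[s sL' s1] /mem_activities[s' s'L' s2]];
  rewrite (USE_trace_alphabet sL') ?(USE_trace_alphabet s'L').
Qed.

(** Traces live in [A], but the transitions of the discovered net are the elements of the finite
    type [X]; replay needs the lifted trace. *)
Lemma seq_lift {A : choiceType} {X : {fset A}} {s : seq A} :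
  {subset s <= X} -> exists s' : seq X, map val s' = s.
Proof.
elim: s => [|c s IH] sub; first by exists [::].
case: IH => [d ds|s' def_s]; first by apply: sub; rewrite inE ds orbT.
have cX : c \in X by apply: sub; rewrite inE eqxx.
by exists (FSetSub cX :: s'); rewrite /= def_s.
Qed.

Lemma USE_trace_ends {A : choiceType} {L : log A} {a_s a_f : A} {s : seq A} :
  a_s \notin activities L -> a_f \notin activities L -> a_s != a_f ->
  s \in USE L a_s a_f -> count_mem a_s s = 1 /\ count_mem a_f s = 1.
Proof.
move=> hs hf hsf /mem_USE[s' s'L ->] /=.
have absent c : c \notin activities L -> count_mem c s' = 0.
  by move=> hc; apply/count_memPn; apply: contra hc => cs'; apply/mem_activities; exists s'.
rewrite -cats1 !count_cat /= !absent // !eqxx (negbTE hsf).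
by rewrite eq_sym (negbTE hsf).
Qed.

Lemma discovered_net_replay {A : choiceType} {L : log A} {a_s a_f : A}
    {D : {fset A * A}} {sol : A * A -> ilp_point (use_alphabet L a_s a_f)}
    {s : seq (use_alphabet L a_s a_f)} :
  let W := discovered_net a_s a_f D sol in
  a_s \notin activities L -> a_f \notin activities L -> a_s != a_f ->
  (forall ab, ab \in D -> exists a b, ilp_feasible (USE L a_s a_f) a b (sol ab)) ->
  map val s \in USE L a_s a_f ->
  replayable ([mset p_i W]%mset : marking W) s /\
  marking_after ([mset p_i W]%mset : marking W) s = [mset p_o W]%mset.
Proof.
move=> W hs hf hsf feas sL'.
have [one_s one_f] := USE_trace_ends hs hf hsf sL'.
rewrite !count_map in one_s one_f.
have consumed_o u : @consumed _ W u (inr true) = 0 by elim: u.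
have produced_i u : @produced _ W u (inr false) = 0 by elim: u.
split.
  move=> [ab|[]] s1 s2 t def_s; last 2 first.
  - by rewrite consumed_o.
  (* The single initial token of [p_i] suffices: a prefix contains [a_s] at most as often as the
     whole trace, that is, once. *)
  - rewrite produced_i addn0 msetnE eqxx -one_s [in leqRHS]def_s -cat_rcons.
    by rewrite count_cat leq_addr.
  have [a [b /ilp_feasible_enough enough]] := feas _ (valP ab).
  by rewrite msetnE /=; apply: enough def_s.
apply/msetP => -[ab|[]]; rewrite marking_afterE !msetnE /=.
- have [a [b /ilp_feasible_balanced balanced]] := feas _ (valP ab).
  by rewrite /consumed /produced /= balanced // subnn.
- by rewrite consumed_o subn0; apply: one_f.
- by rewrite produced_i /consumed [count _ s]one_s.
Qed.

(** A path from [p_i] must start with the transition of [a_s]. Without oracle places that transition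
    has no outgoing arc, since only [a_f] feeds [p_o]. *)
Lemma discovered_net_no_pair {A : choiceType} {X : {fset A}} {a_s a_f : A}
    {sol : A * A -> ilp_point X} :
  a_s != a_f -> ~ workflow_net (discovered_net a_s a_f fset0 sol).
Proof.
move=> hsf [_ _ _ /(_ (inl (inr true)))[[|[p|t] [|[q|t'] s]] []]] //=; last first.
  by rewrite andbF.
move=> /and3P[/eqP t_s + _] _ _; case: q => [[ab]|[|]] //=.
by rewrite t_s (negbTE hsf).
Qed.

Theorem theorem2 (A : choiceType) (R : realFieldType) (L : log A)
    (a_s a_f : A)
    (hs : a_s \notin activities L) (hf : a_f \notin activities L)
    (hsf : a_s != a_f)
    (z : linear_objective R (use_alphabet L a_s a_f))
    (C : log A -> {fset A * A}) (hC : is_causal_oracle C)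
    (W : net A) (hW : ilp_discovery z C W) :
  workflow_net W -> relaxed_sound W.
Proof.
case: hW => sol [solP ->] wf t.
(* Solutions are given only for pairs over the alphabet, while places are indexed by all oracle
   pairs; the oracle hypothesis bridges the gap. *)
have feas ab : ab \in C (USE L a_s a_f) ->
    exists a b, ilp_feasible (USE L a_s a_f) a b (sol ab).
  case: ab => a b abC; have /andP[/= aX bX] := oracle_alphabet hC abC.
  by have [feas_ab _] := solP (FSetSub aX) (FSetSub bX) abC;
    exists (FSetSub aX), (FSetSub bX).
(* The transitions of [a_s] and [a_f] exist even for an empty log, so a trace containing them must
   be secured first. *)
have [s0 s0L] : exists s0, s0 \in L.
  case def_L: (enum_mset L) => [|s0 r].
    suff D0 : C (USE L a_s a_f) = fset0%fset.
      by rewrite D0 in wf; case: (discovered_net_no_pair hsf wf).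
    apply/fsetP => ab; rewrite inE; apply/negP => /hC /andP[+ _].
    by case/mem_activities => s /mem_USE[s']; rewrite -topredE /= def_L.
  by exists s0; rewrite -topredE /= def_L inE eqxx.
have [s sL' ts] : exists2 s, s \in USE L a_s a_f & val t \in s.
  (* An activity of the log is covered by a trace it occurs in; [a_s] and [a_f] occur in every
     extended trace, so [s0] serves. *)
  case/fsetUP: (valP t) => [/mem_activities[s sL ts]|].
    exists (a_s :: rcons s a_f); first by apply/mem_USE; exists s.
    by rewrite inE mem_rcons inE ts !orbT.
  move=> t_sf; exists (a_s :: rcons s0 a_f); first by apply/mem_USE; exists s0.
  by move: t_sf; rewrite !inE mem_rcons inE => /orP[] ->; rewrite ?orbT.
have [w def_s] := seq_lift (USE_trace_alphabet sL').
rewrite -def_s in sL' ts.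
have [ok final] := discovered_net_replay hs hf hsf feas sL'.
by rewrite -final; apply: replay_through ok _; rewrite (mem_map val_inj) in ts.
Qed.
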